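(* Let $n,k,M,j$ be integers with $1\le k\le n$ and $1\le j\le M$, and let $S$ be the (simple) multi-state $k$-out-of-$n$ system with $n$ components, where the system and each component have state set $\{0,1,\dots,M\}$ and the structure function is $\phi(x_1,\dots,x_n)=x_{(n-k+1)}$, with $x_{(1)}\le x_{(2)}\le\dots\le x_{(n)}$ the non-decreasing arrangement of $x_1,\dots,x_n$. Then the ideal $$I_{(k,n),j}=\Big\langle \prod_{i\in\sigma} x_i^{\,j}\ :\ \sigma\subseteq\{1,\dots,n\},\ |\sigma|=k\Big\rangle\subseteq \mathbf{k}[x_1,\dots,x_n]$$ is the $j$-reliability ideal of $S$.
   Context: $\mathbf{k}[x_1,\dots,x_n]$ is a polynomial ring over a field $\mathbf{k}$. A system with $n$ components has a structure function $\phi:\mathcal{S}_1\times\cdots\times\mathcal{S}_n\to\mathcal{S}$, where $\mathcal{S}_i$ is the (finite, ordered) set of states of component $i$ and $\mathcal{S}$ is the set of states of the system; the system is coherent if $\phi$ is non-decreasing with respect to the componentwise order. A tuple of component states $(s_1,\dots,s_n)$ corresponds to the monomial $x_1^{s_1}\cdots x_n^{s_n}$. For a level $j\ge 1$, the $j$-reliability ideal $I_{S,j}$ of a coherent system $S$ is the monomial ideal generated by the monomials corresponding to all tuples $\mathbf{s}$ of component states with $\phi(\mathbf{s})\ge j$; by coherence, a tuple of component states $\mathbf{s}$ satisfies $\phi(\mathbf{s})\geq j$ if and only if its monomial lies in $I_{S,j}$. *)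

(* Defs.v *)
From HB Require Import structures.
From mathcomp Require Import all_boot all_order all_algebra.
From mathcomp Require Import mpoly.

Set Implicit Arguments.
Unset Strict Implicit.
Unset Printing Implicit Defensive.

Import Order.TTheory GRing.Theory.
Local Open Scope ring_scope.

Definition ideal_gen (A : comNzRingType) (G : A -> Prop) (p : A) : Prop :=
  exists s : seq (A * A),
    (forall q, q \in s -> G q.2) /\ p = \sum_(q <- s) q.1 * q.2.

(* The states of component i are 0, ..., comp_max i, and those of the system
   are 0, ..., sys_max, each with the usual order. *)
Record coherent_system (n : nat) : Type := CoherentSystem {
  comp_max : 'I_n -> nat;
  sys_max : nat;
  structure_fun : (forall i : 'I_n, 'I_(comp_max i).+1) -> 'I_sys_max.+1;
  structure_fun_homo : forall s t : forall i : 'I_n, 'I_(comp_max i).+1,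
    (forall i, (s i <= t i)%N) -> (structure_fun s <= structure_fun t)%N
}.

Definition state_monomial (K : fieldType) (n : nat) (S : coherent_system n)
    (s : forall i : 'I_n, 'I_(comp_max S i).+1) : {mpoly K[n]} :=
  'X_[ [multinom (s i : nat) | i < n] ].

Definition reliability_ideal (K : fieldType) (n : nat) (S : coherent_system n)
    (j : nat) : {mpoly K[n]} -> Prop :=
  ideal_gen (fun g => exists s : forall i : 'I_n, 'I_(comp_max S i).+1,
    (j <= structure_fun s)%N /\ g = state_monomial K s).

(* [nth] counts from 0, so x_(n-k+1) is the entry of index n - k. *)
Definition kofn_fun (n k M : nat) (x : 'I_n -> 'I_M.+1) : 'I_M.+1 :=
  nth ord0 (sort <=%O (codom x)) (n - k).

Lemma kofn_fun_homo (n k M : nat) (s t : 'I_n -> 'I_M.+1) :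
  (forall i, (s i <= t i)%N) -> (kofn_fun k s <= kofn_fun k t)%N.
Proof.
move=> le_st; rewrite -[X in is_true X]/(kofn_fun k s <= kofn_fun k t)%O.
have sz (x : 'I_n -> 'I_M.+1) : size (sort <=%O (codom x)) = n.
  by rewrite size_sort size_codom card_ord.
have [le_n|lt_n] := leqP n (n - k).
  by rewrite /kofn_fun !nth_default ?sz.
apply: nth_count_ge; first exact: sort_le_sorted.
rewrite sz lt_n andbT count_sort.
apply: (@leq_trans (count (< kofn_fun k s)%O (codom s))).
  rewrite /codom /image_mem !count_map; apply: sub_count => i /= lt_ti.
  exact: leq_ltn_trans (le_st i) lt_ti.
rewrite -(count_sort <=%O) leqNgt; apply/negP => lt_c.
have := nth_count_lt ord0 (sort_le_sorted (codom s)) lt_c.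
by rewrite -/(kofn_fun k s) ltxx.
Qed.

Definition k_out_of_n (n k M : nat) : coherent_system n :=
  @CoherentSystem n (fun=> M) M (@kofn_fun n k M) (@kofn_fun_homo n k M).

Definition kofn_ideal (K : fieldType) (n k j : nat) : {mpoly K[n]} -> Prop :=
  ideal_gen (fun g => exists sigma : {set 'I_n},
    #|sigma| = k /\ g = \prod_(i in sigma) 'X_i ^+ j).

(* Main.v *)
(* At least k components are in a state >= j exactly when the (n-k+1)-th
   smallest state is >= j. So the generators of the k-out-of-n ideal are the
   monomials of the minimal tuples of level j (state j on sigma, 0 elsewhere),
   and each tuple of level j dominates one of them, hence its monomial is a
   multiple of the corresponding generator. *)
Require Import Defs.
From mathcomp Require Import all_boot all_order all_algebra.
From mathcomp Require Import mpoly.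

Set Implicit Arguments.
Unset Strict Implicit.
Unset Printing Implicit Defensive.

Import Order.TTheory GRing.Theory.
Local Open Scope ring_scope.

(** In a combination of elements of [G], each term [a * g] becomes [(a * c) * h], so the cofactor is
    absorbed into the coefficient. This reduces both inclusions of ideals to divisibility between
    single generators. *)
Lemma ideal_gen_mono (A : comNzRingType) (G H : A -> Prop) :
  (forall g, G g -> exists2 h, H h & exists c, g = c * h) ->
  forall p, ideal_gen G p -> ideal_gen H p.
Proof.
move=> GH _ [s [sG ->]]; elim: s sG => [|[a g] s IHs] sG.
  by exists [::]; rewrite !big_nil.
have [h Hh [c /= def_g]] := GH g (sG (a, g) (mem_head _ _)).
have [|t [tH def_t]] := IHs; first by move=> q sq; apply: sG; rewrite inE sq orbT.
exists ((a * c, h) :: t); split; last first.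
  by rewrite !big_cons /= def_t def_g mulrA.
by move=> q /[!inE] /predU1P[-> | /tH].
Qed.

(** After sorting, the states below [j] fill an initial segment, so the entry of index [n - k] is at
    least [j] iff that segment has length at most [n - k]. *)
Lemma leq_kofn_fun (n k M j : nat) (x : 'I_n -> 'I_M.+1) :
  (1 <= k <= n)%N -> (j <= M)%N ->
  (j <= kofn_fun k x)%N = (k <= #|[set i | j <= x i]|)%N.
Proof.
move=> /andP[k_gt0 le_kn] le_jM.
pose J : 'I_M.+1 := inord j; have defJ : J = j :> nat by rewrite inordK.
have sz : size (sort <=%O (codom x)) = n by rewrite size_sort size_codom card_ord.
have cnt : (count (< J)%O (sort <=%O (codom x)) + #|[set i | j <= x i]| = n)%N.
  rewrite count_sort /codom /image_mem count_map cardE !enumT size_filter.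
  rewrite -[RHS](size_enum_ord n) enumT -(count_predC (preim x (< J)%O)).
  congr (_ + _)%N.
  by apply: eq_count => i; rewrite /= inE -leNgt -defJ.
(* The index [n - k] falls inside the sorted list because [k] is positive, so [nth] does not return
   its default [ord0]. *)
have lt_nk : (n - k < n)%N by rewrite ltn_subrL k_gt0 (leq_trans k_gt0).
have -> : (k <= #|[set i | j <= x i]|)%N =
          (count (< J)%O (sort <=%O (codom x)) <= n - k)%N.
  by rewrite -(leq_add2l (count (< J)%O (sort <=%O (codom x)))) cnt addnC leq_subRL.
rewrite -{1}defJ -[LHS]/(J <= kofn_fun k x)%O.
apply/idP/idP => [le_J | le_c]; last first.
  by apply: nth_count_ge; rewrite ?sort_le_sorted ?le_c ?sz.
rewrite leqNgt; apply/negP => lt_c.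
have := nth_count_lt ord0 (sort_le_sorted (codom x)) lt_c.
by rewrite ltNge le_J.
Qed.

Lemma prod_mpolyX_exp (R : comNzRingType) (n j : nat) (sigma : {set 'I_n}) :
  \prod_(i in sigma) 'X_i ^+ j
    = 'X_[ [multinom (if i \in sigma then j else 0)%N | i < n] ] :> {mpoly R[n]}.
Proof.
rewrite mpolyXE_id big_mkcond; apply: eq_bigr => i _.
by rewrite mnmE; case: ifP.
Qed.

Lemma mpolyX_dvd (R : comNzRingType) (n : nat) (m m' : 'X_{1.. n}) :
  (m' <= m)%MM -> exists c, 'X_[m] = c * 'X_[m'] :> {mpoly R[n]}.
Proof. by move=> /submK <-; exists 'X_[m - m']; rewrite mpolyXD. Qed.

Theorem proposition3p4 (K : fieldType) (n k M j : nat)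
    (hk : (1 <= k <= n)%N) (hj : (1 <= j <= M)%N) (p : {mpoly K[n]}) :
  kofn_ideal k j p <-> reliability_ideal (k_out_of_n n k M) j p.
Proof.
have /andP[j_gt0 le_jM] := hj.
split; apply: ideal_gen_mono => g.
  move=> [sigma [card_sigma ->]].
  exists (\prod_(i in sigma) 'X_i ^+ j); last by exists 1; rewrite mul1r.
  pose s i : 'I_M.+1 := if i \in sigma then inord j else ord0.
  have sE i : s i = (if i \in sigma then j else 0)%N :> nat.
    by rewrite /s; case: ifP => // _; rewrite inordK.
  exists s; split.
    rewrite /= leq_kofn_fun // -card_sigma; apply/subset_leq_card/subsetP => i si.
    by rewrite inE sE si.
  rewrite prod_mpolyX_exp; congr 'X_[_]; apply/mnmP => i.
  by rewrite !mnmE sE.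
(* More than [k] components may be in a state at least [j]; [t] lists exactly [k] of them. *)
move=> [s []]; rewrite /= leq_kofn_fun // => /card_geqP[t [uniq_t size_t sub_t]] ->.
pose sigma := [set i in t].
exists (\prod_(i in sigma) 'X_i ^+ j).
  by exists sigma; rewrite cardsE (card_uniqP uniq_t).
(* Divisibility is now a comparison of exponents: on [sigma], [j] is at most [s i]; elsewhere the
   generator has exponent 0. *)
rewrite prod_mpolyX_exp; apply: mpolyX_dvd; apply/mnm_lepP => i.
by rewrite !mnmE inE; case: ifP => // /sub_t; rewrite inE.
Qed.
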